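(* Let $\mathcal{C}$ be a $J$-category in which all objects are cofibrant models. Let $p:E\to B$, $p':E'\to B'$ and $b:B\to B'$ be morphisms in $\mathcal{C}$ such that $E\text{-}E'\text{-}B'\text{-}B$ is a weak pullback. Then $$\mathrm{secat}(p)\le \min\{\mathrm{cat}(b),\mathrm{secat}(p')\}.$$
   Context: **$J$-category.** A $J$-category $\mathcal{C}$ is a category with a zero object $0$ and three classes of morphisms, called fibrations, cofibrations and weak equivalences, satisfying (J1)-(J5) below. A trivial fibration (resp. trivial cofibration) is a fibration (resp. cofibration) that is also a weak equivalence. An object $B$ is a cofibrant model if every trivial fibration $E\to B$ admits a section. (J1) Isomorphisms are trivial cofibrations and trivial fibrations. Fibrations and cofibrations are closed under composition. If two of $f,g,gf$ are weak equivalences, so is the third. (J2) The pullback of a fibration $p:E\to B$ along any morphism $f:B'\to B$ exists, with projections $\overline p:E'\to B'$ and $\overline f:E'\to E$, and $\overline p$ is a fibration; if $f$ (resp. $p$) is a weak equivalence, so is $\overline f$ (resp. $\overline p$). The dual statement (pushouts of cofibrations) also holds. (J3) Every morphism $f$ has an $F$-factorization $f=p\tau$ ($\tau$ a weak equivalence, $p$ a fibration) and a $C$-factorization $f=\sigma i$ ($i$ a cofibration, $\sigma$ a weak equivalence). (J4) For every object $X$ there is a trivial fibration $\overline X\to X$ with $\overline X$ a cofibrant model. (J5) (Cube axiom) In any commutative cube whose bottom face is a homotopy pushout and whose vertical faces are homotopy pullbacks, the top face is a homotopy pushout. Here a commutative square with maps $D\to C$, $D\to A$, $g:C\to B$, $f:A\to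 B$ is a homotopy pullback if for some (equivalently any) $F$-factorization $C\to E\to B$ of $g$ the induced morphism $D\to A\times_B E$ is a weak equivalence. Homotopy pushouts are defined dually. **Weak pullback** (all objects being cofibrant models). For morphisms $f:A\to B$, $f':A'\to B'$, $b:B\to B'$, one says that $A\text{-}A'\text{-}B'\text{-}B$ is a weak pullback if for some (equivalently any) $F$-factorization $f'=q\tau$, with $\tau:A'\to X$ a weak equivalence and $q:X\to B'$ a fibration, there is a morphism $x:A\to X$ with $qx=bf$ such that the commutative square formed by $x,f,q,b$ is a homotopy pullback. **Join.** Given $f:A\to B$ and $g:C\to B$, choose an $F$-factorization $g=p\tau$, $p:E\to B$; form the pullback $E'=A\times_B E$ with projections $\overline p:E'\to A$, $\overline f:E'\to E$; choose a $C$-factorization $\overline f=\sigma i$, $i:E'\to Z$, $\sigma: Z\to E$; let $A*_BC$ be the pushout of $\overline p$ and $i$. The join morphism of $f$ and $g$ is the morphism $A*_BC\to B$ induced by $f:A\to B$ and $p\sigma:Z\to B$. It is well defined up to weak equivalence. **Weak lifting and weak section** (all objects being cofibrant models). $f:A\to B$ admits a weak lifting along $g:C\to B$ if for some (equivalently any) $F$-factorization $g=p\tau$, with $p:E\to B$, there is $s:A\to E$ with $ps=f$. A morphism $g:C\to B$ admits a weak section if $\mathrm{id}_B$ admits a weak lifting along $g$. **Sectional category.** For $p:E\to B$ define inductively $h_n:*^n_BE\to B$: $h_0=p$ (so $*^0_BE=E$), and $h_n$ is the join morphism of $h_{n-1}:*^{n-1}_BE\to B$ and $p:E\to B$ (with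 $*^n_BE=( *^{n-1}_BE)*_BE$). $\mathrm{secat}(p)$ is the least integer $n\ge 0$ such that $h_n$ admits a weak section, and $\infty$ if there is no such $n$. (An equivalent Whitehead-type definition exists.) **Category of a morphism.** For an object $B'$, the $n$-th Ganea map $p'^n:G^nB'\to B'$ is the morphism $h_n$ constructed from the zero morphism $0\to B'$. For $b:B\to B'$, $\mathrm{cat}(b)$ is the least integer $n\ge0$ such that $b$ admits a weak lifting along $p'^n:G^nB'\to B'$, and $\infty$ if there is none. *)

(* Defs.v *)
From mathcomp Require Import all_boot all_order all_algebra.
From mathcomp Require Import boolp constructive_ereal.

Set Implicit Arguments.
Unset Strict Implicit.
Unset Printing Implicit Defensive.

Declare Scope cat_scope.
Delimit Scope cat_scope with cat.
Local Open Scope cat_scope.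

Record category := Category {
  obj :> Type;
  hom : obj -> obj -> Type;
  idm : forall A, hom A A;
  comp : forall A B C, hom B C -> hom A B -> hom A C;
  compmA : forall A B C D (h : hom C D) (g : hom B C) (f : hom A B),
    comp h (comp g f) = comp (comp h g) f;
  comp1m : forall A B (f : hom A B), comp (idm B) f = f;
  compm1 : forall A B (f : hom A B), comp f (idm A) = f
}.

Arguments hom {c} A B.
Arguments idm {c} A.
Arguments comp {c A B C} g f.

Notation "A ~> B" := (hom A B) (at level 70, no associativity) : cat_scope.
Notation "g \o f" := (comp g f) : cat_scope.

Section Limits.
Context {C : category}.

Definition is_iso (A B : C) (f : A ~> B) : Prop :=
  exists g : B ~> A, g \o f = idm A /\ f \o g = idm B.

Definition is_pullback (A B E P : C) (f : A ~> B) (p : E ~> B)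
    (pA : P ~> A) (pE : P ~> E) : Prop :=
  f \o pA = p \o pE /\
  forall (X : C) (u : X ~> A) (v : X ~> E), f \o u = p \o v ->
    exists! w : X ~> P, pA \o w = u /\ pE \o w = v.

Definition is_pushout (A D Z Q : C) (f : D ~> A) (i : D ~> Z)
    (jA : A ~> Q) (jZ : Z ~> Q) : Prop :=
  jA \o f = jZ \o i /\
  forall (X : C) (u : A ~> X) (v : Z ~> X), u \o f = v \o i ->
    exists! w : Q ~> X, w \o jA = u /\ w \o jZ = v.

End Limits.

(* A category with a zero object and three classes of morphisms, subject to
   no axiom yet. *)
Record jdata := JData {
  jcat :> category;
  zero : jcat;
  from0 : forall X : jcat, zero ~> X;
  from0_uniq : forall (X : jcat) (f : zero ~> X), f = from0 X;
  to0 : forall X : jcat, X ~> zero;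
  to0_uniq : forall (X : jcat) (f : X ~> zero), f = to0 X;
  fib : forall A B : jcat, (A ~> B) -> Prop;
  cof : forall A B : jcat, (A ~> B) -> Prop;
  weq : forall A B : jcat, (A ~> B) -> Prop
}.

Arguments from0 {j} X.
Arguments to0 {j} X.
Arguments fib {j A B} f.
Arguments cof {j A B} f.
Arguments weq {j A B} f.

Section Notions.
Context {C : jdata}.

Definition trivial_fib (A B : C) (f : A ~> B) : Prop := fib f /\ weq f.
Definition trivial_cof (A B : C) (f : A ~> B) : Prop := cof f /\ weq f.

Definition cofibrant_model (B : C) : Prop :=
  forall (E : C) (p : E ~> B), trivial_fib p ->
    exists s : B ~> E, p \o s = idm B.

Definition F_factorization (A B E : C) (f : A ~> B)
    (t : A ~> E) (p : E ~> B) : Prop :=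
  [/\ f = p \o t, weq t & fib p].

Definition C_factorization (A B Z : C) (f : A ~> B)
    (i : A ~> Z) (s : Z ~> B) : Prop :=
  [/\ f = s \o i, weq s & cof i].

(*       dC                                                             *)
(*    D ----> G                                                         *)
(* dA |       | g    The map g is the one that is F-factorized, and for *)
(*    v       v      pushouts dC is the one that is C-factorized.       *)
(*    A ----> B                                                         *)
(*        f                                                             *)
Definition homotopy_pullback (D A G B : C) (dA : D ~> A) (dC : D ~> G)
    (f : A ~> B) (g : G ~> B) : Prop :=
  f \o dA = g \o dC /\
  exists (E : C) (t : G ~> E) (p : E ~> B), F_factorization g t p /\
  exists (P : C) (pA : P ~> A) (pE : P ~> E), is_pullback f p pA pE /\
  exists w : D ~> P, [/\ pA \o w = dA, pE \o w = t \o dC & weq w].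

Definition homotopy_pushout (D A G B : C) (dA : D ~> A) (dC : D ~> G)
    (f : A ~> B) (g : G ~> B) : Prop :=
  f \o dA = g \o dC /\
  exists (Z : C) (s : Z ~> G) (i : D ~> Z), C_factorization dC i s /\
  exists (Q : C) (jA : A ~> Q) (jZ : Z ~> Q), is_pushout dA i jA jZ /\
  exists w : Q ~> B, [/\ w \o jA = f, w \o jZ = g \o s & weq w].

End Notions.

Record is_Jcategory (C : jdata) : Prop := IsJcategory {
  J1_iso_cof : forall (A B : C) (f : A ~> B), is_iso f -> trivial_cof f;
  J1_iso_fib : forall (A B : C) (f : A ~> B), is_iso f -> trivial_fib f;
  J1_fib_comp : forall (X Y Z : C) (f : X ~> Y) (g : Y ~> Z),
    fib f -> fib g -> fib (g \o f);
  J1_cof_comp : forall (X Y Z : C) (f : X ~> Y) (g : Y ~> Z),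
    cof f -> cof g -> cof (g \o f);
  J1_weq_comp : forall (X Y Z : C) (f : X ~> Y) (g : Y ~> Z),
    weq f -> weq g -> weq (g \o f);
  J1_weq_cancel_l : forall (X Y Z : C) (f : X ~> Y) (g : Y ~> Z),
    weq g -> weq (g \o f) -> weq f;
  J1_weq_cancel_r : forall (X Y Z : C) (f : X ~> Y) (g : Y ~> Z),
    weq f -> weq (g \o f) -> weq g;
  J2_pullback : forall (A B E : C) (f : A ~> B) (p : E ~> B), fib p ->
    exists (P : C) (pA : P ~> A) (pE : P ~> E), is_pullback f p pA pE;
  J2_pullback_fib : forall (A B E P : C) (f : A ~> B) (p : E ~> B)
      (pA : P ~> A) (pE : P ~> E), fib p -> is_pullback f p pA pE ->
    [/\ fib pA, weq f -> weq pE & weq p -> weq pA];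
  J2_pushout : forall (A D Z : C) (f : D ~> A) (i : D ~> Z), cof i ->
    exists (Q : C) (jA : A ~> Q) (jZ : Z ~> Q), is_pushout f i jA jZ;
  J2_pushout_cof : forall (A D Z Q : C) (f : D ~> A) (i : D ~> Z)
      (jA : A ~> Q) (jZ : Z ~> Q), cof i -> is_pushout f i jA jZ ->
    [/\ cof jA, weq f -> weq jZ & weq i -> weq jA];
  J3_F : forall (A B : C) (f : A ~> B),
    exists (E : C) (t : A ~> E) (p : E ~> B), F_factorization f t p;
  J3_C : forall (A B : C) (f : A ~> B),
    exists (Z : C) (i : A ~> Z) (s : Z ~> B), C_factorization f i s;
  J4 : forall X : C, exists (X' : C) (p : X' ~> X),
    trivial_fib p /\ cofibrant_model X';
  (* Cube with top face X1 Y1 Z1 T1, bottom face X0 Y0 Z0 T0 and vertical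
     maps x, y, z, t. Commutativity of the other five faces is part of
     [homotopy_pushout] and [homotopy_pullback]. *)
  J5 : forall (X0 Y0 Z0 T0 X1 Y1 Z1 T1 : C)
      (xy0 : X0 ~> Y0) (xz0 : X0 ~> Z0) (yt0 : Y0 ~> T0) (zt0 : Z0 ~> T0)
      (xy1 : X1 ~> Y1) (xz1 : X1 ~> Z1) (yt1 : Y1 ~> T1) (zt1 : Z1 ~> T1)
      (x : X1 ~> X0) (y : Y1 ~> Y0) (z : Z1 ~> Z0) (t : T1 ~> T0),
    yt1 \o xy1 = zt1 \o xz1 ->
    homotopy_pushout xy0 xz0 yt0 zt0 ->
    homotopy_pullback x xy1 xy0 y -> homotopy_pullback x xz1 xz0 z ->
    homotopy_pullback y yt1 yt0 t -> homotopy_pullback z zt1 zt0 t ->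
    homotopy_pushout xy1 xz1 yt1 zt1
}.

(* Least n with P n, or +oo if there is none. *)
Definition least (P : nat -> Prop) : \bar int :=
  match pselect (exists n, `[< P n >]) with
  | left exP => EFin (Posz (ex_minn exP))
  | right _ => +oo%E
  end.

Section SectionalCategory.
Context {C : jdata}.

Definition weak_pullback (A B A' B' : C)
    (f : A ~> B) (f' : A' ~> B') (b : B ~> B') : Prop :=
  exists (X : C) (t : A' ~> X) (q : X ~> B'), F_factorization f' t q /\
  exists x : A ~> X, q \o x = b \o f /\ homotopy_pullback f x b q.

(* [is_join f g h]: h is a join morphism of f and g, for some choice of the
   factorizations, pullback and pushout. *)
Definition is_join (A B G J : C) (f : A ~> B) (g : G ~> B) (h : J ~> B) : Prop :=
  exists (E : C) (t : G ~> E) (p : E ~> B), F_factorization g t p /\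
  exists (P : C) (pA : P ~> A) (pE : P ~> E), is_pullback f p pA pE /\
  exists (Z : C) (i : P ~> Z) (s : Z ~> E), C_factorization pE i s /\
  exists (jA : A ~> J) (jZ : Z ~> J),
    [/\ is_pushout pA i jA jZ, h \o jA = f & h \o jZ = p \o s].

Definition weak_lifting (A B G : C) (f : A ~> B) (g : G ~> B) : Prop :=
  exists (E : C) (t : G ~> E) (p : E ~> B), F_factorization g t p /\
  exists s : A ~> E, p \o s = f.

Definition weak_section (G B : C) (g : G ~> B) : Prop :=
  weak_lifting (idm B) g.

(* [iterated_join p n h]: h is a possible value of h_n. As joins are only
   defined up to weak equivalence, so is h_n. *)
Inductive iterated_join (E B : C) (p : E ~> B) :
    nat -> forall X : C, (X ~> B) -> Prop :=
| iterated_join0 : iterated_join p 0 p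
| iterated_joinS (n : nat) (X Y : C) (h : X ~> B) (k : Y ~> B) :
    iterated_join p n h -> is_join h p k -> iterated_join p n.+1 k.

(* In a J-category all of whose objects are cofibrant models, whether h has a
   weak section (or b a weak lifting along h) does not depend on the choice
   of h, so that "some h" below may be read "any h". *)
Definition secat (E B : C) (p : E ~> B) : \bar int :=
  least (fun n => exists (X : C) (h : X ~> B),
    iterated_join p n h /\ weak_section h).

Definition catm (B B' : C) (b : B ~> B') : \bar int :=
  least (fun n => exists (X : C) (h : X ~> B'),
    iterated_join (from0 B') n h /\ weak_lifting b h).

End SectionalCategory.

(* Main.v *)
(* Write [f <= g] when [f] admits a weak lifting along [g]; this is a preorder
   on the morphisms to a fixed object, and joins are monotone for it.  Factor
   [b] as a weak equivalence [tau] followed by a fibration [b1].  By the cube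
   axiom, pulling back along [b1] commutes with joins, so by induction
   [b1^* h'_n <= tau h_n], where [h'_n] is an iterated join of any
   [r : R ~> B'] with [b1^* r <= tau p].  If [b <= h'_n], then
   [id <= b1^* h'_n <= tau h_n], and since [tau] is a weak equivalence
   [id <= h_n].  The bounds by [cat b] and [secat p'] are the cases
   [r = from0 B'] and [r = p']. *)
Require Import Defs.
From mathcomp Require Import all_boot all_order all_algebra.
From mathcomp Require Import boolp constructive_ereal.

Local Open Scope cat_scope.

Set Implicit Arguments.
Unset Strict Implicit.

(** * Universal properties: pasting and cancelling pullbacks, maps out of pushouts *)

Section PullbacksAndPushouts.
Context {C : category}.

Lemma pullback_lift (A B E P : C) (f : A ~> B) (p : E ~> B) (pA : P ~> A)
    (pE : P ~> E) (X : C) (u : X ~> A) (v : X ~> E) :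
  is_pullback f p pA pE -> f \o u = p \o v ->
  exists w : X ~> P, pA \o w = u /\ pE \o w = v.
Proof. by move=> [_ H] /H[w [Hw _]]; exists w. Qed.

Lemma pullback_eq (A B E P : C) (f : A ~> B) (p : E ~> B) (pA : P ~> A)
    (pE : P ~> E) (X : C) (w w' : X ~> P) :
  is_pullback f p pA pE -> pA \o w = pA \o w' -> pE \o w = pE \o w' -> w = w'.
Proof.
move=> [Hc H] eA eE.
have /H[w0 [_ Hw]] : f \o (pA \o w') = p \o (pE \o w') by rewrite !compmA Hc.
by rewrite -(Hw w) // -(Hw w').
Qed.

Lemma pullbackI (A B E P : C) (f : A ~> B) (p : E ~> B) (pA : P ~> A)
    (pE : P ~> E) :
  f \o pA = p \o pE ->
  (forall (X : C) (u : X ~> A) (v : X ~> E), f \o u = p \o v ->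
    exists w : X ~> P, pA \o w = u /\ pE \o w = v) ->
  (forall (X : C) (w w' : X ~> P),
    pA \o w = pA \o w' -> pE \o w = pE \o w' -> w = w') ->
  is_pullback f p pA pE.
Proof.
move=> Hc Hex Huniq; split=> // X u v /Hex[w [eA eE]].
by exists w; split=> // w' [eA' eE']; apply: Huniq; rewrite ?eA ?eE.
Qed.

Lemma pullback_sym (A B E P : C) (f : A ~> B) (p : E ~> B) (pA : P ~> A)
    (pE : P ~> E) :
  is_pullback f p pA pE -> is_pullback p f pE pA.
Proof.
move=> H; apply: pullbackI => [|X u v e|X w w' e1 e2].
- by case: H.
- by have [w [? ?]] := pullback_lift H (esym e); exists w.
- exact: pullback_eq H e2 e1.
Qed.

Lemma pullback_paste (A B D P Q R : C) (f : A ~> B) (g : B ~> D) (a : P ~> A)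
    (b : Q ~> B) (c : R ~> D) (u : P ~> Q) (v : Q ~> R) :
  is_pullback f b a u -> is_pullback g c b v ->
  is_pullback (g \o f) c a (v \o u).
Proof.
move=> H1 H2; apply: pullbackI => [|X x y e|X w w' e1 e2].
- by rewrite -compmA H1.1 !compmA H2.1.
- rewrite -compmA in e; have [z [ez1 ez2]] := pullback_lift H2 e.
  have [w [ew1 ew2]] := pullback_lift H1 (esym ez1).
  by exists w; rewrite -compmA ew2.
- apply: (pullback_eq H1) => //; apply: (pullback_eq H2); last by rewrite !compmA.
  by rewrite !compmA -H1.1 -!compmA e1.
Qed.

Lemma pullback_cancel (A B D P Q R : C) (f : A ~> B) (g : B ~> D) (a : P ~> A)
    (b : Q ~> B) (c : R ~> D) (u : P ~> Q) (v : Q ~> R) :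
  is_pullback g c b v -> is_pullback (g \o f) c a (v \o u) ->
  f \o a = b \o u -> is_pullback f b a u.
Proof.
move=> H2 H eq; apply: pullbackI => // [X x y e|X w w' e1 e2].
- have [|w [ew1 ew2]] := @pullback_lift _ _ _ _ _ _ _ _ X x (v \o y) H.
    by rewrite -compmA e !compmA H2.1.
  exists w; split=> //; apply: (pullback_eq H2); last by rewrite compmA.
  by rewrite compmA -eq -compmA ew1.
- by apply: (pullback_eq H) => //; rewrite -!compmA e2.
Qed.

Lemma pushout_desc (A D Z Q : C) (f : D ~> A) (i : D ~> Z) (jA : A ~> Q)
    (jZ : Z ~> Q) (X : C) (u : A ~> X) (v : Z ~> X) :
  is_pushout f i jA jZ -> u \o f = v \o i ->
  exists w : Q ~> X, w \o jA = u /\ w \o jZ = v.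
Proof. by move=> [_ H] /H[w [Hw _]]; exists w. Qed.

Lemma pushout_eq (A D Z Q : C) (f : D ~> A) (i : D ~> Z) (jA : A ~> Q)
    (jZ : Z ~> Q) (X : C) (w w' : Q ~> X) :
  is_pushout f i jA jZ -> w \o jA = w' \o jA -> w \o jZ = w' \o jZ -> w = w'.
Proof.
move=> [Hc H] eA eZ.
have /H[w0 [_ Hw]] : (w' \o jA) \o f = (w' \o jZ) \o i by rewrite -!compmA Hc.
by rewrite -(Hw w) // -(Hw w').
Qed.

Lemma is_iso_id (A : C) : is_iso (idm A).
Proof. by exists (idm A); rewrite comp1m. Qed.

End PullbacksAndPushouts.

(** * Base change of factorizations and joins *)

Section JCategory.
Context {C : jdata} (HC : is_Jcategory C).

Lemma weq_id (A : C) : weq (idm A).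
Proof. by case: (J1_iso_fib HC (is_iso_id A)). Qed.

(** A fibration is F-factorized by an identity followed by itself; this lets strict squares enter
    the cube axiom. *)
Lemma pullback_homotopy_pullback (A B E P : C) (f : A ~> B) (p : E ~> B)
    (pA : P ~> A) (pE : P ~> E) :
  fib p -> is_pullback f p pA pE -> homotopy_pullback pA pE f p.
Proof.
move=> fp H; split; first by case: H.
exists E, (idm E), p; split; first by split; rewrite ?compm1 //; exact: weq_id.
exists P, pA, pE; split=> //; exists (idm P).
by rewrite !compm1 comp1m; split=> //; exact: weq_id.
Qed.

Lemma pushout_homotopy_pushout (A D Z Q : C) (f : D ~> A) (i : D ~> Z)
    (jA : A ~> Q) (jZ : Z ~> Q) :
  cof i -> is_pushout f i jA jZ -> homotopy_pushout f i jA jZ.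
Proof.
move=> ci H; split; first by case: H.
exists Z, (idm Z), i; split; first by split; rewrite ?comp1m //; exact: weq_id.
exists Q, jA, jZ; split=> //; exists (idm Q).
by rewrite !comp1m compm1; split=> //; exact: weq_id.
Qed.

(* Both factors of [F_factorization f t p] pull back along a fibration [b]. *)
Lemma F_factorization_pullback (B B' G G' E E' : C) (b : B ~> B')
    (g' : G' ~> B') (t' : G' ~> E') (p' : E' ~> B') (c : G ~> G') (g : G ~> B)
    (d : E ~> E') (e : E ~> B) :
  fib b -> F_factorization g' t' p' -> is_pullback g' b c g ->
  is_pullback p' b d e -> exists t : G ~> E, F_factorization g t e.
Proof.
move=> fb [eg wt fp] Hg He.
have [|t [e1 e2]] := @pullback_lift _ _ _ _ _ _ _ _ _ G (t' \o c) g He.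
  by rewrite compmA -eg Hg.1.
exists t; split=> //.
- rewrite eg -e2 in Hg.
  have H := pullback_cancel He Hg (esym e1).
  have [fd _ _] := J2_pullback_fib HC fb He.
  by have [_ /(_ wt)] := J2_pullback_fib HC fd H.
- by have [] := J2_pullback_fib HC fp (pullback_sym He).
Qed.

(** The pushout square defining [J'] is the bottom of a cube whose vertical faces are strict
    pullbacks with fibrations as vertical maps. The cube axiom makes the top face only a homotopy
    pushout, hence a join [K] weakly equivalent to [J]. *)
Lemma join_pullback (B B' A A' G G' J J' : C) (b : B ~> B')
    (f' : A' ~> B') (g' : G' ~> B') (h' : J' ~> B')
    (a : A ~> A') (f : A ~> B) (c : G ~> G') (g : G ~> B)
    (t : J ~> J') (h : J ~> B) :
  fib b -> is_join f' g' h' -> is_pullback f' b a f -> is_pullback g' b c g ->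
  is_pullback h' b t h ->
  exists (K : C) (k : K ~> B) (w : K ~> J), [/\ is_join f g k, h \o w = k & weq w].
Proof.
move=> fb [E' [t' [p' [Fg' [P' [pA' [pE' [HP' H]]]]]]]] Ha Hc Hh.
case: H => [Z' [i' [s' [[eE' ws' ci'] [jA' [jZ' [HJ' hA' hZ']]]]]]].
have fp' : fib p' by case: Fg'.
have [E [d [e HE]]] := J2_pullback HC p' fb.
have [u Fu] := F_factorization_pullback fb Fg' Hc HE.
have fe : fib e by case: Fu.
have [P [pA [pE HP]]] := J2_pullback HC f fe.
have [|x [xA xE]] := @pullback_lift _ _ _ _ _ _ _ _ _ P (a \o pA) (d \o pE) HP'.
  by rewrite !compmA Ha.1 HE.1 -!compmA HP.1.
have HPA : is_pullback pA' a x pA.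
  apply: pullback_sym; apply: (pullback_cancel HP'); last by rewrite xA.
  rewrite Ha.1 xE; exact: pullback_paste HP (pullback_sym HE).
have HPB := pullback_paste HPA Ha.
have [Z [z [zB HZ]]] := J2_pullback HC (p' \o s') fb.
have [|xz [xz1 xz2]] := @pullback_lift _ _ _ _ _ _ _ _ _ P (i' \o x) (f \o pA) HZ.
  by rewrite -HPB.1 HP'.1 eE' !compmA.
have HPZ : is_pullback i' z x xz.
  apply: (pullback_cancel HZ) => //.
  by rewrite -compmA -eE' -HP'.1 xz2.
have [|yt [yt1 yt2]] := @pullback_lift _ _ _ _ _ _ _ _ _ A (jA' \o a) f Hh.
  by rewrite compmA hA' Ha.1.
have HAJ : is_pullback jA' t a yt.
  by apply: (pullback_cancel Hh) => //; rewrite hA' yt2.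
have [|zt [zt1 zt2]] := @pullback_lift _ _ _ _ _ _ _ _ _ Z (jZ' \o z) zB Hh.
  by rewrite compmA hZ' HZ.1.
have HZJ : is_pullback jZ' t z zt.
  by apply: (pullback_cancel Hh) => //; rewrite hZ' zt2.
have [|s [s1 s2]] := @pullback_lift _ _ _ _ _ _ _ _ _ Z (s' \o z) zB HE.
  by rewrite compmA HZ.1.
have [fd _ _] := J2_pullback_fib HC fb HE.
have [fa _ _] := J2_pullback_fib HC fb Ha.
have [ft _ _] := J2_pullback_fib HC fb Hh.
have [fz _ _] := J2_pullback_fib HC fb HZ.
have ws : weq s.
  have H : is_pullback s' d z s by apply: (pullback_cancel HE) => //; rewrite s2.
  by have [_ /(_ ws')] := J2_pullback_fib HC fd H.
have top : yt \o pA = zt \o xz.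
  apply: (pullback_eq Hh); rewrite !compmA; last by rewrite yt2 zt2 xz2.
  by rewrite yt1 zt1 -!compmA -xA xz1 !compmA HJ'.1.
have [_] := J5 HC top (pushout_homotopy_pushout ci' HJ')
  (pullback_homotopy_pullback fa HPA) (pullback_homotopy_pullback fz HPZ)
  (pullback_homotopy_pullback ft HAJ) (pullback_homotopy_pullback ft HZJ).
(* The C-factorization of [xz] given by the homotopy pushout, followed by [s], is one of [pE]; so
   [Q] is an actual join of [f] and [g]. *)
move=> [Z2 [s0 [i [[ei ws0 ci] [Q [jA [jZ [HQ [w [wA wZ ww]]]]]]]]]].
exists Q, (h \o w), w; split=> //.
exists E, u, e; split=> //; exists P, pA, pE; split=> //.
exists Z2, i, (s \o s0); split.
  split=> //; last exact: (J1_weq_comp HC).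
  rewrite -compmA -ei; apply: (pullback_eq HE); rewrite compmA.
    by rewrite s1 -compmA xz1 compmA -eE' xE.
  by rewrite s2 xz2 HP.1.
exists jA, jZ; split=> //; first by rewrite -compmA wA yt2.
by rewrite -compmA wZ !compmA zt2 s2.
Qed.

(* [A x_B (B x_B1 E1) = A x_B1 E1], so that the construction of the join in [B]
   can be read in [B1]. *)
Lemma join_postcomp (A G B B1 : C) (tau : B ~> B1) (f : A ~> B) (g : G ~> B) :
  weq tau -> exists (J : C) (k : J ~> B),
    is_join f g k /\ is_join (tau \o f) (tau \o g) (tau \o k).
Proof.
move=> wtau.
have [E1 [t1 [p1 [e1 wt1 fp1]]]] := J3_F HC (tau \o g).
have [E [e [d HE]]] := J2_pullback HC tau fp1.
have [fe /(_ wtau) wd _] := J2_pullback_fib HC fp1 HE.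
have [t [te td]] := pullback_lift HE e1.
have wt : weq t by apply: (J1_weq_cancel_l HC wd); rewrite td.
have [P [pA [pE HP]]] := J2_pullback HC f fe.
have [Z [i [s [es ws ci]]]] := J3_C HC pE.
have [J [jA [jZ HJ]]] := J2_pushout HC pA ci.
have [|k [kA kZ]] := @pushout_desc _ _ _ _ _ _ _ _ _ B f (e \o s) HJ.
  by rewrite HP.1 es compmA.
exists J, k; split.
  exists E, t, e; split=> //; exists P, pA, pE; split=> //.
  by exists Z, i, s; split=> //; exists jA, jZ.
exists E1, t1, p1; split=> //; exists P, pA, (d \o pE); split.
  exact: pullback_paste HP HE.
exists Z, i, (d \o s); split.
  by split=> //; [rewrite es compmA|exact: (J1_weq_comp HC)].
by exists jA, jZ; split=> //; rewrite -compmA ?kA // kZ !compmA HE.1.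
Qed.

(** * Weak liftings and iterated joins over cofibrant models *)

Hypothesis Hcof : forall X : C, cofibrant_model X.

(* [t] need not admit a strict inverse over [B], but the trivial fibration
   [W ~> E] obtained by F-factorizing [G ~> E x_B E'] has a section. *)
Lemma fib_extension (G E E' B : C) (t : G ~> E) (p : E ~> B) (p' : E' ~> B)
    (m : G ~> E') :
  weq t -> fib p' -> p' \o m = p \o t -> exists e : E ~> E', p' \o e = p.
Proof.
move=> wt fp' em.
have [P [pE [pE' HP]]] := J2_pullback HC p fp'.
have [fpE _ _] := J2_pullback_fib HC fp' HP.
have [v [v1 v2]] := pullback_lift HP (esym em).
have [W [j [q [ej wj fq]]]] := J3_F HC v.
have [|s es] := Hcof (p := pE \o q).
  split; first exact: (J1_fib_comp HC).
  by apply: (J1_weq_cancel_r HC wj); rewrite -compmA -ej v1.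
exists (pE' \o (q \o s)).
by rewrite compmA -HP.1 -compmA [pE \o _]compmA es compm1.
Qed.

(** Passes from some F-factorization of [g] to any: [fib_extension] maps one to the other over
    [B]. *)
Lemma weak_lifting_factorization (A G B E : C) (f : A ~> B) (g : G ~> B)
    (t : G ~> E) (p : E ~> B) :
  weak_lifting f g -> F_factorization g t p -> exists s : A ~> E, p \o s = f.
Proof.
move=> [E0 [t0 [p0 [[e0 wt0 _] [s es]]]]] [e _ fp].
have [|x ex] := @fib_extension _ _ _ _ t0 p0 p t wt0 fp; first by rewrite -e.
by exists (x \o s); rewrite compmA ex.
Qed.

Lemma weak_liftingI (A K G B : C) (f : A ~> B) (k : K ~> B) (g : G ~> B)
    (a : A ~> K) (w : G ~> K) :
  k \o a = f -> k \o w = g -> weq w -> weak_lifting f g.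
Proof.
move=> ea ew ww.
have [E [t [p [e wt fp]]]] := J3_F HC g.
have [|x ex] := @fib_extension _ _ _ _ w k p t ww fp; first by rewrite -e.
by exists E, t, p; split=> //; exists (x \o a); rewrite compmA ex.
Qed.

(** The second lifting is defined on [K]; [fib_extension] extends it to the replacement [E0] of [K]
    where the first one lands. *)
Lemma weak_lifting_trans (A K G B : C) (f : A ~> B) (k : K ~> B) (g : G ~> B) :
  weak_lifting f k -> weak_lifting k g -> weak_lifting f g.
Proof.
move=> [E0 [t0 [p0 [[e0 wt0 _] [s es]]]]] [E [t [p [Fg [s' es']]]]].
have [_ _ fp] := Fg.
have [|x ex] := @fib_extension _ _ _ _ t0 p0 p s' wt0 fp; first by rewrite es'.
by exists E, t, p; split=> //; exists (x \o s); rewrite compmA ex.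
Qed.

Lemma weak_lifting_precomp (A' A G B : C) (f : A ~> B) (g : G ~> B)
    (a : A' ~> A) :
  weak_lifting f g -> weak_lifting (f \o a) g.
Proof.
move=> [E [t [p [Fg [s <-]]]]]; exists E, t, p; split=> //.
by exists (s \o a); rewrite compmA.
Qed.

(** Base change along [tau] turns an F-factorization of [tau \o h] into one of [h], and a lift of
    [tau] into a section. *)
Lemma weak_section_postcomp (X B B1 : C) (tau : B ~> B1) (h : X ~> B) :
  weq tau -> weak_lifting tau (tau \o h) -> weak_section h.
Proof.
move=> wtau [K [t [q [[eq wt fq] [s es]]]]].
have [K' [e [d HK]]] := J2_pullback HC tau fq.
have [fe /(_ wtau) wd _] := J2_pullback_fib HC fq HK.
have [x [xe xd]] := pullback_lift HK eq.
have [|y [ye yd]] := @pullback_lift _ _ _ _ _ _ _ _ _ B (idm B) s HK.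
  by rewrite compm1 es.
exists K', x, e; split; last by exists y.
by split=> //; apply: (J1_weq_cancel_l HC wd); rewrite xd.
Qed.

(* [K] is a fibrant replacement of [A'] over [B], and [J] maps to a join [J3] of
   [K] and [G'] to which [J'] is weakly equivalent: [J' ~> JK] and [JK ~> J3] are
   the pushouts of the weak equivalence [A' ~> K] and of the trivial
   cofibration [ZK ~> Z3]. *)
Lemma join_mono (A G J A' G' J' B : C) (f : A ~> B) (g : G ~> B) (h : J ~> B)
    (f' : A' ~> B) (g' : G' ~> B) (h' : J' ~> B) :
  is_join f g h -> is_join f' g' h' ->
  weak_lifting f f' -> weak_lifting g g' -> weak_lifting h h'.
Proof.
move=> [E [t [p [[eg wt fp] [P [pA [pE [HP H]]]]]]]].
case: H => [Z [i [s [[es ws ci] [jA [jZ [HJ hA hZ]]]]]]].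
move=> [E' [t' [p' [Fg' [P' [pA' [pE' [HP' H]]]]]]]].
case: H => [Z' [i' [s' [[es' ws' ci'] [jA' [jZ' [HJ' hA' hZ']]]]]]].
move=> [K [k [q [[ek wk fq] [x ex]]]]] /weak_lifting_factorization /(_ Fg') [y0 ey0].
have [_ _ fp'] := Fg'.
have [|y ey] := @fib_extension _ _ _ _ t p p' y0 wt fp'; first by rewrite ey0.
have [PK [kK [kE HPK]]] := J2_pullback HC q fp'.
have [fkK _ _] := J2_pullback_fib HC fp' HPK.
have [|m [mK mE]] := @pullback_lift _ _ _ _ _ _ _ _ _ P (x \o pA) (y \o pE) HPK.
  by rewrite !compmA ex ey HP.1.
have [|n [nK nE]] := @pullback_lift _ _ _ _ _ _ _ _ _ P' (k \o pA') pE' HPK.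
  by rewrite compmA -ek HP'.1.
have wn : weq n.
  have H : is_pullback k kK pA' n.
    by apply: (pullback_cancel HPK) => //; rewrite -ek nE.
  by have [_ /(_ wk)] := J2_pullback_fib HC fkK H.
(* Pushing out along [n] yields a C-factorization [sK \o iK] of [kE]. *)
have [ZK [iK [n' HZK]]] := J2_pushout HC n ci'.
have [ciK /(_ wn) wn' _] := J2_pushout_cof HC ci' HZK.
have [|sK [sK1 sK2]] := @pushout_desc _ _ _ _ _ _ _ _ _ E' kE s' HZK.
  by rewrite nE es'.
have wsK : weq sK by apply: (J1_weq_cancel_r HC wn'); rewrite sK2.
(* Nothing provides a map [Z ~> ZK]. Both are glued along [P] into [V], and C-factorizing [V ~> E']
   gives [Z3], which receives [Z] and contains [ZK] by a trivial cofibration. *)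
have [V [vK [vZ HV]]] := J2_pushout HC (iK \o m) ci.
have [cvK _ _] := J2_pushout_cof HC ci HV.
have [|sV [sV1 sV2]] := @pushout_desc _ _ _ _ _ _ _ _ _ E' sK (y \o s) HV.
  by rewrite compmA sK1 mE es compmA.
have [Z3 [i3 [s3 [es3 ws3 ci3]]]] := J3_C HC sV.
have cZ3 : cof (i3 \o vK) by exact: (J1_cof_comp HC).
have wZ3 : weq (i3 \o vK).
  by apply: (J1_weq_cancel_l HC ws3); rewrite compmA -es3 sV1.
have [cjA' _ _] := J2_pushout_cof HC ci' HJ'.
have [JK [jK [j' HJK]]] := J2_pushout HC k cjA'.
have [_ /(_ wk) wj' _] := J2_pushout_cof HC cjA' HJK.
have [|zK [zK1 zK2]] :=
    @pushout_desc _ _ _ _ _ _ _ _ _ JK (jK \o kK) (j' \o jZ') HZK.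
  by rewrite -!compmA nK -HJ'.1 !compmA HJK.1.
have [|hK [hK1 hK2]] := @pushout_desc _ _ _ _ _ _ _ _ _ B q h' HJK.
  by rewrite -ek hA'.
have hzK : hK \o zK = p' \o sK.
  apply: (pushout_eq HZK); rewrite -!compmA.
    by rewrite zK1 sK1 compmA hK1 HPK.1.
  by rewrite zK2 sK2 compmA hK2 hZ'.
have [J3 [lK [l3 HJ3]]] := J2_pushout HC zK cZ3.
have [_ _ /(_ wZ3) wlK] := J2_pushout_cof HC cZ3 HJ3.
have [|h3 [h3K h3Z]] := @pushout_desc _ _ _ _ _ _ _ _ _ B hK (p' \o s3) HJ3.
  by rewrite hzK -compmA [s3 \o _]compmA -es3 sV1.
have [|r [rA rZ]] := @pushout_desc _ _ _ _ _ _ _ _ _ J3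
    (lK \o (jK \o x)) (l3 \o (i3 \o vZ)) HJ.
  rewrite -!compmA -HV.1 -mK [jK \o _]compmA -zK1 !compmA HJ3.1.
  by rewrite -!compmA.
apply: (@weak_liftingI _ J3 _ _ _ h3 _ r (lK \o j')).
- apply: (pushout_eq HJ); rewrite -compmA.
    by rewrite rA compmA h3K compmA hK1 ex hA.
  by rewrite rZ compmA h3Z -compmA [s3 \o _]compmA -es3 sV2 compmA ey hZ.
- by rewrite compmA h3K hK2.
- exact: (J1_weq_comp HC).
Qed.

(** In the induction step, [join_postcomp] gives one join that serves over [B] and over [B1],
    [join_pullback] splits the pulled back join, and [join_mono] compares the two. Quantifying over
    all pullbacks avoids fixing choices. *)
Lemma iterated_join_pullback (B B1 B' E R : C) (tau : B ~> B1) (b1 : B1 ~> B')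
    (p : E ~> B) (r : R ~> B') :
  weq tau -> fib b1 ->
  (forall (R1 : C) (c : R1 ~> R) (r1 : R1 ~> B1),
    is_pullback r b1 c r1 -> weak_lifting r1 (tau \o p)) ->
  forall (n : nat) (X' : C) (h' : X' ~> B'), iterated_join r n h' ->
  exists (X : C) (h : X ~> B), iterated_join p n h /\
    forall (X1 : C) (c : X1 ~> X') (h1 : X1 ~> B1),
      is_pullback h' b1 c h1 -> weak_lifting h1 (tau \o h).
Proof.
move=> wtau fb1 Hr n X' h'; elim=> {n X' h'} [|n X' Y' h' k' _].
  by exists E, p; split=> //; exact: iterated_join0.
move=> [X [h [Hh Hh1]]] Hk'.
have [Y [k [Hk Hk1]]] := join_postcomp h p wtau.
exists Y, k; split; first exact: iterated_joinS Hh Hk.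
move=> Y1 c k1 Hc.
have [X1 [cX [h1 HX]]] := J2_pullback HC h' fb1.
have [R1 [cR [r1 HR]]] := J2_pullback HC r fb1.
have [K [l [w [Hl ew ww]]]] := join_pullback fb1 Hk' HX HR Hc.
apply: (weak_lifting_trans (k := l)).
  exact: weak_liftingI (compm1 _) ew ww.
exact: join_mono Hl Hk1 (Hh1 _ _ _ HX) (Hr _ _ _ HR).
Qed.

Lemma weak_section_iterated_join (E B E' B' R : C) (p : E ~> B)
    (p' : E' ~> B') (b : B ~> B') (r : R ~> B') (a : R ~> E') :
  weak_pullback p p' b -> r = p' \o a ->
  forall (n : nat) (X' : C) (h' : X' ~> B'),
    iterated_join r n h' -> weak_lifting b h' ->
  exists (X : C) (h : X ~> B), iterated_join p n h /\ weak_section h.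
Proof.
move=> [Y [t [q [[ep' _ _] [x [_ [_ H]]]]]]] er n X' h' Hh' Hb.
case: H => [X2 [t2 [q2 [[eq _ fq2] [P [pB [pX [HP [w [wB _ ww]]]]]]]]]].
have [B1 [tau [b1 [eb wtau fb1]]]] := J3_F HC b.
have [|X [h [Hh Hlift]]] :=
  @iterated_join_pullback B B1 B' E R tau b1 p r wtau fb1 _ n X' h' Hh'.
  move=> R1 c r1 HR.
  (* [v : P ~> P1] is a base change of [tau], so [v \o w] is a weak equivalence from [E] over [B1];
     and [R1] maps to [P1] through [a]. *)
  have [P1 [d [e HP1]]] := J2_pullback HC b1 fq2.
  have [fd _ _] := J2_pullback_fib HC fq2 HP1.
  have [|v [vd ve]] := @pullback_lift _ _ _ _ _ _ _ _ _ P (tau \o pB) pX HP1.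
    by rewrite compmA -eb HP.1.
  have wv : weq v.
    have Hv : is_pullback tau d pB v.
      by apply: (pullback_cancel HP1) => //; rewrite -eb ve.
    by have [_ /(_ wtau)] := J2_pullback_fib HC fd Hv.
  have [|y [yd _]] := @pullback_lift _ _ _ _ _ _ _ _ _ R1 r1
      (t2 \o (t \o (a \o c))) HP1.
    by rewrite -HR.1 er ep' eq -!compmA.
  apply: (weak_liftingI (w := v \o w) yd); last exact: (J1_weq_comp HC).
  by rewrite compmA vd -compmA wB.
exists X, h; split=> //; apply: (weak_section_postcomp wtau).
(* The lift [s] of [b] extends along [tau] to a lift [s1] of [b1], that is, a section of the base
   change of [u] to [B1]: a weak section of [h1]. *)
have [K [k [u [Fu [s es]]]]] := Hb.
have [_ _ fu] := Fu.
have [|s1 es1] := @fib_extension _ _ _ _ tau b1 u s wtau fu; first by rewrite es.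
have [X1 [c [h1 HX1]]] := J2_pullback HC h' fb1.
have [K1 [d [e HK1]]] := J2_pullback HC u fb1.
have [k1 Fk1] := F_factorization_pullback fb1 Fu HX1 HK1.
have [|y [_ ye]] := @pullback_lift _ _ _ _ _ _ _ _ _ B1 s1 (idm B1) HK1.
  by rewrite es1 compm1.
rewrite -[X in weak_lifting X _]comp1m; apply: weak_lifting_precomp.
apply: weak_lifting_trans (Hlift _ _ _ HX1).
by exists K1, k1, e; split=> //; exists y.
Qed.

End JCategory.

(** * Comparison of least integers and the inequality *)

Lemma least_le (P Q : nat -> Prop) :
  (forall n, Q n -> P n) -> (least P <= least Q)%E.
Proof.
move=> QP; rewrite /least.
case: pselect => [exP|nP]; case: pselect => [exQ|nQ]; rewrite ?leey //; last first.
  by case: nP; case: exQ => n /asboolP/QP Pn; exists n; apply/asboolP.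
rewrite lee_fin lez_nat; case: ex_minnP => k _ kmin; case: ex_minnP => m /asboolP Qm _.
by apply: kmin; apply/asboolP; exact: QP.
Qed.

Unset Implicit Arguments.
Set Strict Implicit.

Theorem theorem20 (C : jdata) (HC : is_Jcategory C)
    (Hcof : forall X : C, cofibrant_model X)
    (E B E' B' : C) (p : E ~> B) (p' : E' ~> B') (b : B ~> B')
    (Hwp : weak_pullback p p' b) :
  (secat p <= Order.min (catm b) (secat p'))%E.
Proof.
have key := weak_section_iterated_join HC Hcof Hwp.
rewrite /Order.min; case: ifP => _; apply: least_le => n [X [h [Hh Hb]]].
  (* Bound by [catm b]: the zero morphism factors through [p']. *)
  by apply: key Hh Hb; exact: esym (from0_uniq (p' \o from0 E')).
(* Bound by [secat p']: here [a] is an identity, and a weak section precomposed with [b] is a weak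
   lifting of [b]. *)
apply: key (esym (compm1 _)) _ _ _ Hh _.
by rewrite -[b]comp1m; exact: weak_lifting_precomp.
Qed.
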